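(* Let $n\ge 1$ be an integer, let $q$ be a prime power, let $\beta=(\beta_0,\beta_1,\dots,\beta_n)$ be a vector of real weights, and let $P$ be a given poset or configuration. Suppose that there exists a number $c(P)$ such that every family $\mathcal{F}\subseteq 2^{[n]}$ which does not contain $P$ satisfies $l^*(\mathcal{F},\beta)\le c(P)$. Then every family $\mathcal{V}$ of subspaces of $\mathbb{F}_q^n$ which contains no copy of $P$ satisfies $l_q^*(\mathcal{V},\beta)\le c(P)$.
   Context: $[n]=\{1,\dots,n\}$, and $\mathcal{B}_n=2^{[n]}$ is the Boolean lattice of all subsets of $[n]$ ordered by inclusion. $\mathcal{L}_n(q)$ is the linear lattice of all subspaces of $\mathbb{F}_q^n$ ordered by inclusion. $\binom{n}{k}_q=\prod_{0\le i\le k-1}\frac{q^{n-i}-1}{q^{k-i}-1}$ is the Gaussian binomial coefficient (the number of $k$-dimensional subspaces of $\mathbb{F}_q^n$). Weighted Lubell functions: for $\mathcal{F}\subseteq 2^{[n]}$ and a family $\mathcal{V}$ of subspaces of $\mathbb{F}_q^n$, $$l^*(\mathcal{F},\beta)=\sum_{i=0}^n\frac{\beta_i|\mathcal{F}_i|}{\binom{n}{i}},\qquad l_q^*(\mathcal{V},\beta)=\sum_{i=0}^n\frac{\beta_i|\mathcal{V}_i|}{\binom{n}{i}_q},$$ where $\mathcal{F}_i=\{F\in\mathcal{F}:|F|=i\}$ and $\mathcal{V}_i=\{V\in\mathcal{V}:\dim V=i\}$. Containment of $P$. If $P$ is a poset, a family $\mathcal{F}$ (of subsets or of subspaces, ordered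 by inclusion) contains $P$ weakly if there is an injective map $\psi:P\to\mathcal{F}$ such that $u\le_P v$ implies $\psi(u)\subseteq\psi(v)$, and strongly if there is an injective $\psi:P\to\mathcal{F}$ such that $u\le_P v$ if and only if $\psi(u)\subseteq\psi(v)$; the theorem is for either notion, the same one being used for subsets and for subspaces. More generally, a configuration $P$ is a pattern that makes sense both in $\mathcal{B}_n$ and in $\mathcal{L}_n(q)$: certain subfamilies of $2^{[n]}$ and certain subfamilies of $\mathcal{L}_n(q)$ are designated as copies of $P$, in such a way that for every basis $\{v_1,\dots,v_n\}$ of $\mathbb{F}_q^n$ the (inclusion- and intersection-preserving) map $H\mapsto \mathrm{span}\{v_x: x\in H\}$, $H\subseteq[n]$, sends copies of $P$ in $2^{[n]}$ to copies of $P$ in $\mathcal{L}_n(q)$. A family contains $P$ if some subfamily of it is a copy of $P$. (Example: $s$ pairwise disjoint members, where subspaces are disjoint if they intersect in $\{0\}$.) *)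

(* Defs.v *)
From HB Require Import structures.
From mathcomp Require Import all_boot all_order all_algebra.
From mathcomp Require Import reals.

Set Implicit Arguments.
Unset Strict Implicit.
Unset Printing Implicit Defensive.

Import Order.TTheory GRing.Theory Num.Theory.
Local Open Scope ring_scope.

(* The subspaces of a finite space form a finType: the library only declares a
   choiceType structure and keeps the matrix encoding in an internal module. *)
Section FiniteVspace.
Import VectorInternalTheory.
Variables (F : finFieldType) (vT : vectType F).

HB.instance Definition _ := [Countable of {vspace vT} by <:].
HB.instance Definition _ := [Finite of {vspace vT} by <:].

End FiniteVspace.

(* The ground set [n] is represented by 'I_n, and F_q^n by 'rV[F]_n. *)

Definition gauss_binomial (R : realType) (q n k : nat) : R :=
  \prod_(i < k) ((q%:R ^+ (n - i) - 1) / (q%:R ^+ (k - i) - 1)).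

Definition lubell (R : realType) (n : nat) (A : {set {set 'I_n}})
    (beta : 'I_n.+1 -> R) : R :=
  \sum_(i < n.+1) beta i * #|[set H in A | #|H| == i]|%:R / 'C(n, i)%:R.

Definition lubell_q (R : realType) (F : finFieldType) (n : nat)
    (V : {set {vspace 'rV[F]_n}}) (beta : 'I_n.+1 -> R) : R :=
  \sum_(i < n.+1)
    beta i * #|[set U in V | (\dim U)%VS == i]|%:R / gauss_binomial R #|F| n i.

Definition weakly_contains (d : Order.disp_t) (P : porderType d)
    (T : finType) (incl : rel T) (A : {set T}) : Prop :=
  exists psi : P -> T,
    [/\ injective psi, forall u, psi u \in A &
        forall u v, (u <= v)%O -> incl (psi u) (psi v)].

Definition strongly_contains (d : Order.disp_t) (P : porderType d)
    (T : finType) (incl : rel T) (A : {set T}) : Prop :=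
  exists psi : P -> T,
    [/\ injective psi, forall u, psi u \in A &
        forall u v, (u <= v)%O <-> incl (psi u) (psi v)].

Definition contains_copy (T : finType) (copy : {set T} -> Prop)
    (A : {set T}) : Prop :=
  exists2 C : {set T}, C \subset A & copy C.

Definition span_of (F : finFieldType) (n : nat) (v : n.-tuple 'rV[F]_n)
    (H : {set 'I_n}) : {vspace 'rV[F]_n} :=
  <<[seq tnth v x | x in H]>>%VS.

Record configuration (F : finFieldType) (n : nat) := Configuration {
  set_copy : {set {set 'I_n}} -> Prop;
  space_copy : {set {vspace 'rV[F]_n}} -> Prop;
  copy_span : forall v : n.-tuple 'rV[F]_n, basis_of fullv v ->
    forall C, set_copy C -> space_copy [set span_of v H | H in C]
}.

(* A poset, to be contained weakly or strongly, or a configuration. *)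
Inductive pattern (F : finFieldType) (n : nat) : Type :=
| WeakPoset (d : Order.disp_t) (P : porderType d)
| StrongPoset (d : Order.disp_t) (P : porderType d)
| Config (P : configuration F n).

Definition set_contains (F : finFieldType) (n : nat) (P : pattern F n)
    (A : {set {set 'I_n}}) : Prop :=
  match P with
  | WeakPoset _ P => weakly_contains P
      (fun H K : {set 'I_n} => H \subset K) A
  | StrongPoset _ P => strongly_contains P
      (fun H K : {set 'I_n} => H \subset K) A
  | Config P => contains_copy (set_copy P) A
  end.

Definition space_contains (F : finFieldType) (n : nat) (P : pattern F n)
    (V : {set {vspace 'rV[F]_n}}) : Prop :=
  match P with
  | WeakPoset _ P => weakly_contains P
      (fun U W : {vspace 'rV[F]_n} => (U <= W)%VS) V
  | StrongPoset _ P => strongly_contains P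
      (fun U W : {vspace 'rV[F]_n} => (U <= W)%VS) V
  | Config P => contains_copy (space_copy P) V
  end.

(* Main.v *)
(** The family V pulls back, along each basis v of F_q^n, to the family of those
    H whose span lies in V; this contains no P, so its Lubell function is at
    most c.  For dim U = |H|, the number of bases with span_of v H = U is
    prod_(j < i) (q^i - q^j) * prod_(i <= j < n) (q^n - q^j) with i = |H|, i.e.
    the proportion 1 / binom(n, i)_q of all bases.  Hence the average of the
    pulled-back Lubell functions over all bases is exactly l_q^*(V, beta). *)

Require Import Defs.
From HB Require Import structures.
From mathcomp Require Import all_boot all_order all_algebra.
From mathcomp Require Import reals.
From mathcomp Require Import fingroup perm finfield ring.

Set Implicit Arguments.
Unset Strict Implicit.
Unset Printing Implicit Defensive.

Import Order.TTheory GRing.Theory Num.Theory.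
Local Open Scope ring_scope.

(** * Permutations of the indices and freeness *)

(** [s] lists [H] first and its complement afterwards. This reduces counting bases with prescribed
    [span_of v H] to an initial segment of indices. *)
Lemma exists_perm_initial (n : nat) (H : {set 'I_n}) :
  exists s : 'S_n, forall j, (s j \in H) = (j < #|H|)%N.
Proof.
pose e := enum H ++ enum (~: H).
have size_e : size e = n by rewrite size_cat -!cardE cardsC card_ord.
have e_uniq : uniq e.
  rewrite cat_uniq !enum_uniq andbT /=; apply/hasPn => x.
  by rewrite !mem_enum inE.
have e_size : size e == n by apply/eqP.
pose t := Tuple e_size.
have t_inj : injective (tnth t).
  by move=> i j; apply: tuple_uniqP.
exists (perm t_inj) => j; rewrite permE (tnth_nth j) /= nth_cat -cardE.
case: ltnP => Hj; first by rewrite -mem_enum mem_nth // -cardE.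
apply/negbTE; rewrite -in_setC -mem_enum mem_nth //.
by rewrite -(ltn_add2l #|H|) subnKC // -cardE cardsC card_ord.
Qed.

Section FreeTuples.
Variables (K : fieldType) (vT : vectType K) (n : nat).
Implicit Types v : n.-tuple vT.

(** The indices outside [s] complete [s] to a permutation of all indices, so the selected vectors
    are a prefix of a permutation of [v]. *)
Lemma free_map_tnth v (s : seq 'I_n) :
  free v -> uniq s -> free [seq tnth v x | x <- s].
Proof.
move=> v_free s_uniq.
suff: free ([seq tnth v x | x <- s] ++
            [seq tnth v x | x <- enum (predC (mem s))]).
  by apply: catl_free.
rewrite -map_cat -(@perm_free _ _ v) // -{1}(map_tnth_enum v).
apply: perm_map; apply: uniq_perm; rewrite ?enum_uniq //.
  rewrite cat_uniq s_uniq enum_uniq andbT /=; apply/hasPn => x.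
  by rewrite mem_enum.
by move=> x; rewrite mem_cat !mem_enum !inE orbN.
Qed.

Lemma free_tuple_perm v (s : 'S_n) :
  free [tuple tnth v (s i) | i < n] = free v.
Proof.
have E (w : n.-tuple vT) (t : 'S_n) :
    free w -> free [tuple tnth w (t i) | i < n].
  move=> wf; rewrite /=.
  rewrite (map_comp (tnth w) t) free_map_tnth // map_inj_uniq ?enum_uniq //.
  exact: perm_inj.
apply/idP/idP => [/(E _ s^-1%g)|]; last exact: E.
by congr free; congr val; apply: eq_from_tnth => i; rewrite !tnth_mktuple permKV.
Qed.

End FreeTuples.

(** * From subsets to subspaces along a fixed free tuple *)

Section SpanOf.
Variables (F : finFieldType) (n : nat) (v : n.-tuple 'rV[F]_n).
Hypothesis v_free : free v.
Implicit Types H K : {set 'I_n}.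

Lemma dim_span_of H : \dim (span_of v H) = #|H|.
Proof.
have /eqP -> : free [seq tnth v x | x in H] by rewrite free_map_tnth ?enum_uniq.
by rewrite size_map -cardE.
Qed.

Lemma span_of_sub H K : (span_of v H <= span_of v K)%VS = (H \subset K).
Proof.
apply/idP/idP => [sHK|/subsetP sHK].
  apply/subsetP => x xH; apply: contraT => xK.
  (* For [x] in [H] but not in [K], freeness along [x :: enum K] keeps [tnth v x] out of the span of
     [K]. *)
  have : free [seq tnth v y | y <- x :: enum K].
    by rewrite free_map_tnth //= mem_enum xK enum_uniq.
  rewrite /= free_cons => /andP[/negP xK_span _]; case: xK_span.
  apply: (subvP sHK); apply: memv_span; apply: map_f; by rewrite mem_enum.
apply: sub_span => _ /mapP[x xH ->]; apply: map_f.
by move: xH; rewrite !mem_enum; apply: sHK.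
Qed.

Lemma span_of_inj : injective (span_of v).
Proof.
move=> H K E; apply/eqP.
by rewrite eqEsubset -!span_of_sub E !subvv.
Qed.

(** Equal dimensions make inclusion enough, and inclusion is tested on generators. Prescribing the
    span thus becomes a condition on single vectors, as in [card_free_tuples]. *)
Lemma span_of_eq H (U : {vspace 'rV[F]_n}) : \dim U = #|H| ->
  (span_of v H == U) = [forall x in H, tnth v x \in U].
Proof.
move=> dimU; rewrite eqEdim dim_span_of dimU leqnn andbT.
apply/span_subvP/forall_inP => [sHU x xH|sHU _ /mapP[x xH ->]].
  by apply: sHU; apply: map_f; rewrite mem_enum.
by apply: sHU; rewrite -mem_enum.
Qed.

End SpanOf.

(** * Counting free tuples and bases *)

Section CountFree.
Variables (F : finFieldType) (m : nat).
Local Notation vT := 'rV[F]_m.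

Lemma card_vspace_diff (U W : {vspace vT}) : (U <= W)%VS ->
  #|[pred x : vT | (x \in W) && (x \notin U)]| = (#|F| ^ \dim W - #|F| ^ \dim U)%N.
Proof.
move=> sUW.
rewrite -(@card_vspace F vT _ W) -(@card_vspace F vT _ U).
rewrite -(cardID (mem U) (mem W)).
rewrite [X in (X + _ - _)%N](_ : _ = #|U|) ?addKn.
  by apply: eq_card => x; rewrite !inE andbC.
by apply: eq_card => x; rewrite !inE andb_idl // => /(subvP sUW).
Qed.

(* With W j = U for j < i and W j the full space afterwards, this counts the
   bases whose first i vectors span U; the tuple s makes the induction work. *)
Lemma card_free_tuples (k : nat) (s : seq vT) (W : nat -> {vspace vT}) :
  free s -> (<<s>> <= W 0%N)%VS -> (forall j, (W j <= W j.+1)%VS) ->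
  #|[set t : k.-tuple vT | free (t ++ s) &&
      [forall j, tnth t j \in W j]]| =
  (\prod_(j < k) (#|F| ^ \dim (W j) - #|F| ^ (size s + j)))%N.
Proof.
elim: k s W => [|k IH] s W s_free sW0 Wmono.
  rewrite big_ord0 (_ : [set _ | _] = [set [tuple]]) ?cards1 //.
  apply/setP => t; rewrite tuple0 !inE eqxx s_free /=.
  by apply/forallP => -[].
(* [D] holds the choices of the first vector [x]; [B x] holds the remaining tuples, with [x] moved
   into [s] and [W] shifted by one. *)
pose D := [pred x : vT | (x \in W 0%N) && (x \notin <<s>>%VS)].
pose B x := [set t : k.-tuple vT | free (t ++ (x :: s)) &&
      [forall j, tnth t j \in W (val j).+1]].
transitivity (\sum_(x | D x) #|B x|)%N.
  rewrite -sum1_card.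
  under [RHS]eq_bigr do rewrite -sum1_card.
  rewrite pair_big_dep /=.
  rewrite (reindex (fun p : vT * k.-tuple vT => [tuple of p.1 :: p.2])) /=.
    apply: eq_bigl => -[x t]; rewrite !inE /=.
    have -> : free (x :: t ++ s) = free (t ++ x :: s).
      by apply: perm_free; rewrite perm_sym -cat1s perm_catCA.
    have -> : [forall j : 'I_k.+1, tnth [tuple of x :: t] j \in W j] =
        (x \in W 0%N) && [forall j : 'I_k, tnth t j \in W (val j).+1].
      apply/forallP/andP => [tW|[xW /forallP tW] j].
        split; first exact: (tW ord0).
        by apply/forallP => j; move: (tW (lift ord0 j)); rewrite tnthS.
      by case: (unliftP ord0 j) => [j' ->|->] //; rewrite tnthS; apply: tW.
    case: (boolP (free (t ++ x :: s))) => [f|]; last by rewrite !andbF.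
    by move: (catr_free f); rewrite free_cons => /andP[-> _]; rewrite !andbT.
  exists (fun t => (thead t, [tuple of behead t])) => [[x t] _|t _] /=.
    by congr pair; apply: val_inj.
  by rewrite -tuple_eta.
transitivity (\sum_(x | D x)
    \prod_(j < k) (#|F| ^ \dim (W (val j).+1) - #|F| ^ (size s + (val j).+1)))%N.
  apply: eq_bigr => x /andP[xW xs]; rewrite (IH (x :: s) (fun j => W j.+1)) //.
  - by apply: eq_bigr => j _; rewrite /= addSnnS.
  - by rewrite free_cons xs.
  - apply: subv_trans (Wmono 0%N).
    by rewrite span_cons subv_add sW0 andbT -memvE.
(* The product is the same for every [x] in [D], and the size of [D] is the factor for [j = 0]. *)
rewrite sum_nat_const card_vspace_diff // big_ord_recl addn0.
by move/eqP: s_free => ->.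
Qed.

Lemma card_bases :
  #|[set v : m.-tuple vT | free v]| = (\prod_(j < m) (#|F| ^ m - #|F| ^ j))%N.
Proof.
have := @card_free_tuples m [::] (fun=> fullv) (nil_free _).
rewrite span_nil sub0v dimvf /dim /= mul1n => <- //.
apply: eq_card => t; rewrite !inE cats0 [X in _ && X](_ : _ = true) ?andbT //.
by apply/forallP => j; rewrite memvf.
Qed.

(** With the indices of [H] brought to the front, the first [#|H|] vectors range over [U] and the
    others over the whole space; freeness and [\dim U = #|H|] make the former span [U]. *)
Lemma card_bases_span (H : {set 'I_m}) (U : {vspace vT}) : \dim U = #|H| ->
  #|[set v : m.-tuple vT | free v && (span_of v H == U)]| =
  (\prod_(j < m) (#|F| ^ (if (j < #|H|)%N then #|H| else m) - #|F| ^ j))%N.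
Proof.
move=> dimU; have [s sH] := exists_perm_initial H.
pose W j := if (j < #|H|)%N then U else fullv.
have Wmono j : (W j <= W j.+1)%VS.
  rewrite /W; case: (ltnP j.+1) => [/ltnW -> //|_]; exact: subvf.
have := @card_free_tuples m [::] W (nil_free _).
rewrite span_nil sub0v => /(_ isT Wmono) E.
transitivity #|[set t : m.-tuple vT | free (t ++ [::]) &&
      [forall j, tnth t j \in W j]]|; last first.
  rewrite E; apply: eq_bigr => j _; rewrite /W.
  by case: ifP => _; rewrite ?dimU // dimvf /dim /= mul1n.
pose f (t : m.-tuple vT) := [tuple tnth t (s i) | i < m].
have f_inj : injective f.
  move=> t u E2; apply: eq_from_tnth => i.
  by have := congr1 (fun w => tnth w (s^-1%g i)) E2; rewrite !tnth_mktuple permKV.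
rewrite -[RHS](card_preimset _ f_inj); apply: eq_card => t.
rewrite !inE cats0 free_tuple_perm; case: (boolP (free t)) => //= t_free.
rewrite span_of_eq //; apply/forall_inP/forallP => [tU j|tW x xH].
  by rewrite tnth_mktuple /W -sH; case: ifP => [/tU|_] //; rewrite memvf.
by have := tW (s^-1%g x); rewrite tnth_mktuple permKV /W -sH permKV xH.
Qed.

End CountFree.

(** * Averaging over all bases *)

Lemma card_bases_gt0 (F : finFieldType) (n : nat) :
  (0 < #|[set v : n.-tuple 'rV[F]_n | free v]|)%N.
Proof.
rewrite card_bases prodn_gt0 // => j.
by rewrite subn_gt0 ltn_exp2l ?finNzRing_gt1.
Qed.

(** Since [q^m - q^j = q^j (q^(m-j) - 1)], the factors with [j >= #|H|] cancel between the two
    counts, and the others leave those of the Gaussian binomial. *)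
Lemma card_bases_span_gauss (R : realType) (F : finFieldType) (n : nat)
    (H : {set 'I_n}) (U : {vspace 'rV[F]_n}) : \dim U = #|H| ->
  #|[set v : n.-tuple 'rV[F]_n | free v && (span_of v H == U)]|%:R =
  #|[set v : n.-tuple 'rV[F]_n | free v]|%:R / gauss_binomial R #|F| n #|H|.
Proof.
move=> dimU; rewrite (card_bases_span dimU) card_bases.
have q_gt1 : 1 < #|F|%:R :> R by rewrite ltr1n finNzRing_gt1.
have Hn : (#|H| <= n)%N by rewrite -[X in (_ <= X)%N]card_ord max_card.
have E m j : (j < m)%N ->
    (#|F| ^ m - #|F| ^ j)%:R = #|F|%:R ^+ j * (#|F|%:R ^+ (m - j) - 1) :> R.
  move=> jm; rewrite natrB ?leq_exp2l ?finNzRing_gt1 ?(ltnW jm) // !natrX.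
  by rewrite mulrBr mulr1 -exprD subnKC // ltnW.
have nz m j : (j < m)%N -> #|F|%:R ^+ (m - j) - 1 != 0 :> R.
  by move=> jm; rewrite subr_eq0 gt_eqF // exprn_egt1 // -lt0n subn_gt0.
rewrite /gauss_binomial !natr_prod.
(* Padding the Gaussian binomial with factors 1 up to [n] allows a comparison factor by factor. *)
rewrite (big_ord_widen n (fun i => (#|F|%:R ^+ (n - i) - 1) /
  (#|F|%:R ^+ (#|H| - i) - 1))) // [X in _ = _ / X]big_mkcond /= -prodf_div.
apply: eq_bigr => j _; case: ifP => jH; last by rewrite divr1.
rewrite !E //.
by field; rewrite ?nz.
Qed.

(* Double counting of the pairs (v, H) with v a basis and span_of v H in V. *)
Lemma sum_lubell_bases (R : realType) (F : finFieldType) (n : nat)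
    (beta : 'I_n.+1 -> R) (V : {set {vspace 'rV[F]_n}}) :
  \sum_(v : n.-tuple 'rV[F]_n | free v)
    lubell [set H | span_of v H \in V] beta =
  #|[set v : n.-tuple 'rV[F]_n | free v]|%:R * lubell_q V beta.
Proof.
set B := #|_|%:R.
rewrite /lubell exchange_big mulr_sumr /=; apply: eq_bigr => i _.
rewrite -mulr_suml -mulr_sumr mulrA mulrCA -!mulrA; congr (_ * _).
set Vi := [set U in V | _].
transitivity ((\sum_(H : {set 'I_n} | #|H| == i) \sum_(U in Vi)
    #|[set v : n.-tuple 'rV[F]_n | free v && (span_of v H == U)]|)%:R
      / 'C(n, i)%:R : R).
  congr (_ / _); rewrite -natr_sum; congr _%:R.
  (* Membership of [span_of v H] in [V] becomes a sum of indicators over [U] in [Vi]; the span has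
     dimension [i] because [v] is free and [#|H| = i]. *)
  rewrite (eq_bigr (fun v : n.-tuple 'rV[F]_n => \sum_(H : {set 'I_n} | #|H| == i)
      \sum_(U in Vi) (span_of v H == U)))%N.
    rewrite exchange_big; apply: eq_bigr => H _.
    rewrite exchange_big; apply: eq_bigr => U _.
    by rewrite -big_mkcondr -sum1_card; apply: eq_bigl => v; rewrite inE.
  move=> v v_free; rewrite -sum1_card.
  rewrite [RHS](eq_bigr (fun H => (span_of v H \in V) : nat)).
    by rewrite -big_mkcondr; apply: eq_bigl => H; rewrite !inE andbC.
  move=> H /eqP Hi; rewrite -big_mkcondr.
  case: (boolP (span_of v H \in V)) => HV.
    rewrite (big_pred1 (span_of v H)) // => U /=.
    apply/andP/eqP => [[_ /eqP->]|->] //.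
    by rewrite inE HV dim_span_of // Hi eqxx.
  rewrite big1 // => U /andP[]; rewrite inE => /andP[UV _] /eqP E.
  by rewrite E UV in HV.
rewrite natr_sum (eq_bigr (fun=> #|Vi|%:R * (B / gauss_binomial R #|F| n i))); last first.
  move=> H /eqP Hi; rewrite natr_sum -sum1_card natr_sum mulr_suml.
  apply: eq_bigr => U; rewrite inE => /andP[_ /eqP dimU].
  by rewrite mul1r card_bases_span_gauss -?Hi // dimU.
have C_draws : 'C(n, i) = #|[pred H : {set 'I_n} | #|H| == i]|.
  by have := card_draws 'I_n i; rewrite card_ord => <-; rewrite cardsE.
(* All ['C(n, i)] sets [H] contribute equally, which cancels the denominator of [lubell], nonzero
   because [i <= n]. *)
rewrite C_draws sumr_const -[X in X / _]mulr_natr.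
rewrite mulfK /B; last by rewrite -C_draws pnatr_eq0 -lt0n bin_gt0 -ltnS.
by rewrite mulrCA.
Qed.

(** [span_of v] is injective and preserves and reflects inclusion, so it carries a copy of a poset
    in the pulled-back family to one in [V]; for configurations [copy_span] does this. *)
Lemma not_set_contains_preim_span (F : finFieldType) (n : nat)
    (P : pattern F n) (V : {set {vspace 'rV[F]_n}}) (v : n.-tuple 'rV[F]_n) :
  free v -> ~ space_contains P V ->
  ~ set_contains P [set H | span_of v H \in V].
Proof.
move=> v_free; apply: contra_not; case: P => [d P|d P|P] /=.
- case=> psi [psi_inj psiV psi_le]; exists (span_of v \o psi); split.
  + exact: inj_comp (span_of_inj v_free) psi_inj.
  + by move=> u; have := psiV u; rewrite inE.
  + by move=> u w uw; rewrite /= span_of_sub // psi_le.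
- case=> psi [psi_inj psiV psi_le]; exists (span_of v \o psi); split.
  + exact: inj_comp (span_of_inj v_free) psi_inj.
  + by move=> u; have := psiV u; rewrite inE.
  + by move=> u w; rewrite /= span_of_sub.
- case=> C /subsetP CV copyC; exists [set span_of v H | H in C].
    by apply/subsetP => _ /imsetP[H /CV HV ->]; rewrite inE in HV.
  apply: copy_span copyC.
  by rewrite basisEfree v_free subvf dimvf /dim /= mul1n size_tuple leqnn.
Qed.

Theorem theorem1p11 (R : realType) (n q : nat) (F : finFieldType)
    (beta : 'I_n.+1 -> R) (P : pattern F n) (c : R) :
  (1 <= n)%N ->
  (exists p k : nat, [/\ prime p, (0 < k)%N & q = (p ^ k)%N]) ->
  #|F| = q ->
  (forall A : {set {set 'I_n}}, ~ set_contains P A -> lubell A beta <= c) ->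
  forall V : {set {vspace 'rV[F]_n}},
    ~ space_contains P V -> lubell_q V beta <= c.
Proof.
move=> _ _ _ lubell_le V notPV.
(* Scaling by the positive number of bases turns the claim into an inequality between two sums over
   bases, proved term by term. *)
rewrite -(ler_pM2l (x := #|[set v : n.-tuple 'rV[F]_n | free v]|%:R));
  last by rewrite ltr0n card_bases_gt0.
rewrite -sum_lubell_bases mulr_natl -sum1_card -sumrMnr.
rewrite [leRHS](eq_bigl (fun v : n.-tuple 'rV[F]_n => free v)); last first.
  by move=> v; rewrite inE.
apply: ler_sum => v v_free; apply: lubell_le.
exact: not_set_contains_preim_span.
Qed.
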